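(* Let $G$ be a finite group, $N$ a normal subgroup of $G$, $R\subseteq G$, and let $X=(R;S)$ be a pseudo-Cayley graph. If $X$ is $N^{\wedge}$-rough generating, then the graph $\overline{X}''=(N^{\wedge}(R);N^{\wedge}(S)^{\ast})$ is connected. Similarly, if $X$ is $N_{-}$-rough generating, then the graph $\underline{X}''=(N_{-}(R);N_{-}(S))$ is connected.
   Context: Graphs are simple and undirected: a graph is a pair (vertex set, edge set) with edges being 2-element subsets of the vertex set. A non-empty graph is connected if any two vertices are linked by a path. Let $G$ be a finite group with identity $1$. Let $S\subset G$ with $1\notin S$ and $s\in S\Rightarrow s^{-1}\in S$. If $R\subseteq G$ is a subset (not necessarily a subgroup) with $S\subseteq R$ and $SR\subseteq R$, where $SR=\{sr: s\in S,r\in R\}$, the pseudo-Cayley graph $(R;S)$ has vertex set $R$, with an edge between two vertices $r$ and $rs$ (both in $R$) if and only if $s\in S$. For a normal subgroup $N$ of $G$ and $A\subseteq G$, put $N_{-}(A)=\{x\in G: xN\subseteq A\}$, $N^{\wedge}(A)=\{x\in G: xN\cap A\neq\emptyset\}$ and $N^{\wedge}(A)^{\ast}=N^{\wedge}(A)\setminus\{1\}$. For a pseudo-Cayley graph $X=(R;S)$, put $\overline{X}''=(N^{\wedge}(R);N^{\wedge}(S)^{\ast})$ and $\underline{X}''=(N_{-}(R);N_{-}(S))$; these are again pseudo-Cayley graphs. $X$ is called $N^{\wedge}$-rough generating if $N^{\wedge}(R)$ is a subgroup of $G$ and $N^{\wedge}(S)$ is a generating set for $N^{\wedge}(R)$;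 it is called $N_{-}$-rough generating if $N_{-}(R)$ is a subgroup of $G$ and $N_{-}(S)$ is a generating set for $N_{-}(R)$. *)

(* Defs.v *)
From HB Require Import structures.
From mathcomp Require Import all_boot all_fingroup.

Set Implicit Arguments.
Unset Strict Implicit.
Unset Printing Implicit Defensive.

Local Open Scope group_scope.

Record sgraph (T : finType) := SGraph {
  vertices : {set T};
  edges : {set {set T}};
  edgesP : forall e, e \in edges -> e \subset vertices /\ #|e| = 2
}.

Definition adj (T : finType) (X : sgraph T) : rel T :=
  fun x y => [set x; y] \in edges X.

Definition connected (T : finType) (X : sgraph T) : Prop :=
  vertices X != set0 /\ {in vertices X &, forall x y, connect (adj X) x y}.

(* The pair (R;S), with R = pcR and S = pcS subsets of the finite group G. *)
Record pseudo_cayley (gT : finGroupType) (G : {group gT}) := PseudoCayley {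
  pcR : {set gT};
  pcS : {set gT};
  pcR_sub : pcR \subset G;
  pcS_1 : 1 \notin pcS;
  pcS_inv : forall s, s \in pcS -> s^-1 \in pcS;
  pcS_sub : pcS \subset pcR;
  pcSR_sub : pcS * pcR \subset pcR
}.

Section Graph.
Variables (gT : finGroupType) (G : {group gT}) (X : pseudo_cayley G).

Definition pc_edges : {set {set gT}} :=
  [set [set r; r * s] | r in pcR X, s in pcS X & r * s \in pcR X].

Lemma pc_edgesP e : e \in pc_edges -> e \subset pcR X /\ #|e| = 2.
Proof.
case/imset2P=> r s rR; rewrite inE => /andP[sS rsR] ->; split.
  by apply/subsetP=> x; rewrite !inE => /orP[]/eqP->.
rewrite cards2 -{1}[r]mulg1 (inj_eq (mulgI r)) eq_sym.
by case: eqP sS => // ->; rewrite (negPf (pcS_1 X)).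
Qed.

Definition pc_graph : sgraph gT := SGraph pc_edgesP.

End Graph.

Section Approximations.
Variables (gT : finGroupType) (G N : {group gT}).

Definition lower_approx (A : {set gT}) : {set gT} :=
  [set x in G | x *: N \subset A].

Definition upper_approx (A : {set gT}) : {set gT} :=
  [set x in G | x *: N :&: A != set0].

Lemma upper_approxP (A : {set gT}) x :
  reflect (x \in G /\ exists2 n, n \in N & x * n \in A) (x \in upper_approx A).
Proof.
rewrite inE; apply: (iffP andP) => -[xG]; last first.
  case=> n nN xnA; split=> //; apply/set0Pn; exists (x * n).
  by rewrite inE xnA andbT mem_lcoset mulKg.
case/set0Pn=> y; rewrite inE => /andP[/lcosetP[n nN ->] yA].
by split=> //; exists n.
Qed.

Lemma lower_approxP (A : {set gT}) x :
  reflect (x \in G /\ forall n, n \in N -> x * n \in A) (x \in lower_approx A).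
Proof.
rewrite inE; apply: (iffP andP) => -[xG H]; split=> //.
  by move=> n nN; apply: (subsetP H); rewrite mem_lcoset mulKg.
by apply/subsetP=> y /lcosetP[n nN ->]; apply: H.
Qed.

Hypothesis nNG : N <| G.
Variable X : pseudo_cayley G.

Let memJ n x : x \in G -> n \in N -> n ^ x \in N.
Proof. by move=> xG nN; rewrite memJ_norm // (subsetP (normal_norm nNG)). Qed.

Lemma upper_R_sub : upper_approx (pcR X) \subset G.
Proof. by apply/subsetP=> x; rewrite inE => /andP[]. Qed.

Lemma upper_S_1 : 1 \notin upper_approx (pcS X) :\ 1.
Proof. by rewrite setD11. Qed.

Lemma upper_S_inv s :
  s \in upper_approx (pcS X) :\ 1 -> s^-1 \in upper_approx (pcS X) :\ 1.
Proof.
case/setD1P=> s1 /upper_approxP[sG [n nN snS]]; apply/setD1P.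
split; first by rewrite invg_eq1.
apply/upper_approxP; rewrite groupV; split=> //.
exists (n^-1 ^ s^-1); first by rewrite memJ ?groupV.
by rewrite -conjgC -invMg pcS_inv.
Qed.

Lemma upper_S_sub : upper_approx (pcS X) :\ 1 \subset upper_approx (pcR X).
Proof.
apply/subsetP=> x /setD1P[_ /upper_approxP[xG [n nN xnS]]].
by apply/upper_approxP; split=> //; exists n => //; apply: (subsetP (pcS_sub X)).
Qed.

Lemma upper_SR_sub :
  (upper_approx (pcS X) :\ 1) * upper_approx (pcR X)
    \subset upper_approx (pcR X).
Proof.
apply/subsetP=> _ /mulsgP[x y /setD1P[_ /upper_approxP[xG [n nN xnS]]]
  /upper_approxP[yG [m mN ymR]] ->].
apply/upper_approxP; split; first by rewrite groupM.
exists (n ^ y * m); first by rewrite groupM ?memJ.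
apply: (subsetP (pcSR_sub X)).
have -> : x * y * (n ^ y * m) = (x * n) * (y * m).
  by rewrite conjgE !mulgA mulgK.
exact: mem_mulg.
Qed.

Definition upper_pc : pseudo_cayley G :=
  PseudoCayley upper_R_sub upper_S_1 upper_S_inv upper_S_sub upper_SR_sub.

Lemma lower_R_sub : lower_approx (pcR X) \subset G.
Proof. by apply/subsetP=> x; rewrite inE => /andP[]. Qed.

Lemma lower_S_1 : 1 \notin lower_approx (pcS X).
Proof.
apply/negP=> /lower_approxP[_ /(_ 1 (group1 N))].
by rewrite mulg1 (negPf (pcS_1 X)).
Qed.

Lemma lower_S_inv s :
  s \in lower_approx (pcS X) -> s^-1 \in lower_approx (pcS X).
Proof.
case/lower_approxP=> sG H; apply/lower_approxP; rewrite groupV; split=> // n nN.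
have -> : s^-1 * n = (s * n^-1 ^ s)^-1.
  by rewrite -conjgC invMg invgK.
by rewrite pcS_inv // H // memJ ?groupV.
Qed.

Lemma lower_S_sub : lower_approx (pcS X) \subset lower_approx (pcR X).
Proof.
apply/subsetP=> x /lower_approxP[xG H]; apply/lower_approxP; split=> // n nN.
by apply: (subsetP (pcS_sub X)); apply: H.
Qed.

Lemma lower_SR_sub :
  lower_approx (pcS X) * lower_approx (pcR X) \subset lower_approx (pcR X).
Proof.
apply/subsetP=> _ /mulsgP[x y /lower_approxP[xG Hx] /lower_approxP[yG Hy] ->].
apply/lower_approxP; split=> [|n nN]; first by rewrite groupM.
apply: (subsetP (pcSR_sub X)); rewrite -mulgA mem_mulg ?Hy //.
by rewrite -[x]mulg1 Hx ?group1.
Qed.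

Definition lower_pc : pseudo_cayley G :=
  PseudoCayley lower_R_sub lower_S_1 lower_S_inv lower_S_sub lower_SR_sub.

End Approximations.

(* Both approximations are included in G by construction, so [group_set] says
   that they are subgroups of G. *)
Definition upper_rough_generating (gT : finGroupType) (G N : {group gT})
    (X : pseudo_cayley G) : Prop :=
  group_set (upper_approx G N (pcR X)) /\
  <<upper_approx G N (pcS X)>> = upper_approx G N (pcR X).

Definition lower_rough_generating (gT : finGroupType) (G N : {group gT})
    (X : pseudo_cayley G) : Prop :=
  group_set (lower_approx G N (pcR X)) /\
  <<lower_approx G N (pcS X)>> = lower_approx G N (pcR X).

(* Main.v *)
Require Import Defs.
From mathcomp Require Import all_boot all_fingroup.

Local Open Scope group_scope.

(** When S generates R, R is a subgroup, and for x, y in R the element x^-1 y is a word in S.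
    Multiplying x on the right by its successive letters walks from x to y inside R.
    [pc_graph_connected] proves this; both approximations are instances. *)

Lemma pc_graph_adj (gT : finGroupType) (G : {group gT}) (X : pseudo_cayley G)
    r s :
  r \in pcR X -> s \in pcS X -> r * s \in pcR X ->
  adj (pc_graph X) r (r * s).
Proof. by move=> rR sS rsR; apply: imset2_f; rewrite // inE sS. Qed.

Lemma pc_graph_connected (gT : finGroupType) (G : {group gT})
    (X : pseudo_cayley G) :
  <<pcS X>> = pcR X -> connected (pc_graph X).
Proof.
move=> genR; split; rewrite /= -genR.
  by apply/set0Pn; exists 1; rewrite group1.
move=> x y xR yR; rewrite -(mulKVg x y).
have /gen_prodgP[n [c cS ->]]: x^-1 * y \in <<pcS X>> by rewrite groupM ?groupV.
elim: n c cS => [|n IHn] c cS; first by rewrite big_ord0 mulg1.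
(* Splitting off the last letter leaves a prefix ending at the vertex [r]; that letter is the final
   edge. *)
rewrite big_ord_recr mulgA; set r := x * _.
have rR: r \in <<pcS X>>.
  by rewrite groupM // group_prod // => i _; rewrite mem_gen.
apply: connect_trans (IHn _ (fun i => cS _)) (connect1 _).
by apply: pc_graph_adj; rewrite -?genR // groupM // mem_gen.
Qed.

Theorem theorem6p7 (gT : finGroupType) (G N : {group gT}) (nNG : N <| G)
    (X : pseudo_cayley G) :
  (upper_rough_generating N X -> connected (pc_graph (upper_pc nNG X))) /\
  (lower_rough_generating N X -> connected (pc_graph (lower_pc nNG X))).
Proof.
split=> -[_ genR]; apply: pc_graph_connected => //=.
(* Only the upper case remains: removing 1 from a set does not change the subgroup it generates. *)
by rewrite genD1id.
Qed.
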